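(* Let $\mathcal{M}=(E,\rho)$ be a $q$-polymatroid. Fix a non-degenerate symmetric bilinear form $\langle\cdot\mid\cdot\rangle$ on $E$ and let $\mathcal{M}^*=(E,\rho^* )$ be the dual of $\mathcal{M}$ with respect to $\langle\cdot\mid\cdot\rangle$. Let $V\in\mathcal{V}(E)$. Then $V$ is a spanning space in $\mathcal{M}$ if and only if $V^\perp$ is strongly independent in $\mathcal{M}^*$. Likewise, $V$ is a minimal spanning space in $\mathcal{M}$ if and only if $V^\perp$ is maximally strongly independent in $\mathcal{M}^*$.
   Context: Throughout, $\mathbb{F}=\mathbb{F}_q$ is a finite field and $E$ is a finite-dimensional $\mathbb{F}$-vector space. $V\leq W$ means that $V$ is a subspace of $W$, and $\mathcal{V}(E)$ is the set of all subspaces of $E$. A $q$-rank function on $E$ is a map $\rho:\mathcal{V}(E)\to\mathbb{Q}_{\geq0}$ such that for all $V,W\in\mathcal{V}(E)$: (R1) $0\leq\rho(V)\leq\dim V$; (R2) $V\leq W$ implies $\rho(V)\leq\rho(W)$; (R3) $\rho(V+W)+\rho(V\cap W)\leq\rho(V)+\rho(W)$. A $q$-polymatroid on $E$ is a pair $\mathcal{M}=(E,\rho)$ with $\rho$ a $q$-rank function on $E$. Let $\mathcal{M}=(E,\rho)$ be a $q$-polymatroid. A subspace $V\in\mathcal{V}(E)$ is a spanning space if $\rho(V)=\rho(E)$; it is a minimal spanning space if it is a spanning space and no proper subspace of $V$ is a spanning space. A subspace $V\in\mathcal{V}(E)$ is strongly independent if $\rho(V)=\dim V$; it is maximally strongly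 independent if it is strongly independent and not properly contained in a strongly independent subspace. Given a non-degenerate symmetric bilinear form $\langle\cdot\mid\cdot\rangle$ on $E$, put $V^\perp=\{w\in E\mid \langle v\mid w\rangle=0\text{ for all }v\in V\}$ for $V\in\mathcal{V}(E)$. The dual of $\mathcal{M}=(E,\rho)$ with respect to the form is $\mathcal{M}^*=(E,\rho^* )$, where $\rho^*(V)=\dim V+\rho(V^\perp)-\rho(E)$. It is known that $\mathcal{M}^*$ is again a $q$-polymatroid and that $\mathcal{M}^{**}=\mathcal{M}$. *)

(* Defs.v *)
From HB Require Import structures.
From mathcomp Require Import all_boot all_order all_algebra.
From mathcomp Require Import lra zify.

Set Implicit Arguments.
Unset Strict Implicit.
Unset Printing Implicit Defensive.

Import Order.TTheory GRing.Theory Num.Theory.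
Local Open Scope ring_scope.

Definition is_q_rank_function (F : finFieldType) (E : vectType F)
    (rho : {vspace E} -> rat) : Prop :=
  [/\ forall V, 0 <= rho V <= (\dim V)%:R,
      forall V W, (V <= W)%VS -> rho V <= rho W
    & forall V W, rho (V + W)%VS + rho (V :&: W)%VS <= rho V + rho W].

Record qPolymatroid (F : finFieldType) (E : vectType F) := QPolymatroid {
  rank_fun :> {vspace E} -> rat;
  rank_funP : is_q_rank_function rank_fun
}.

Definition spanning_space (F : finFieldType) (E : vectType F)
    (M : qPolymatroid E) (V : {vspace E}) : Prop :=
  M V = M {:E}%VS.

Definition minimal_spanning_space (F : finFieldType) (E : vectType F)
    (M : qPolymatroid E) (V : {vspace E}) : Prop :=
  spanning_space M V /\
  forall W : {vspace E}, (W <= V)%VS -> W != V -> ~ spanning_space M W.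

Definition strongly_independent (F : finFieldType) (E : vectType F)
    (M : qPolymatroid E) (V : {vspace E}) : Prop :=
  M V = (\dim V)%:R.

Definition maximally_strongly_independent (F : finFieldType) (E : vectType F)
    (M : qPolymatroid E) (V : {vspace E}) : Prop :=
  strongly_independent M V /\
  forall W : {vspace E}, (V <= W)%VS -> V != W -> ~ strongly_independent M W.

(* [orthov form V] is the space of all u with form u v = 0 for all v in V
   (see mem_orthovP); since the form is symmetric, this is V^perp. *)
Definition dual_rank (F : finFieldType) (E : vectType F) (form : {symmetric E})
    (rho : {vspace E} -> rat) (V : {vspace E}) : rat :=
  (\dim V)%:R + rho (orthov form V) - rho {:E}%VS.

Section DualIsQPolymatroid.
Variables (F : finFieldType) (E : vectType F) (form : {symmetric E}).
Implicit Types U V W : {vspace E}.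
Local Notation "V ^!" := (orthov form V).

Lemma dim_cap_lkers (I : Type) (r : seq I) (f : I -> 'Hom(E, F^o)) U :
  (\dim U <= \dim (U :&: \bigcap_(i <- r) lker (f i)) + size r)%N.
Proof.
elim: r => [|i r IH]; first by rewrite big_nil capvf addn0.
rewrite big_cons [(lker _ :&: _)%VS]capvC capvA addnS -addSn.
apply: leq_trans IH _; rewrite leq_add2r.
set K := (U :&: _)%VS.
rewrite -(limg_ker_dim (f i) K) -addn1 leq_add2l.
by apply: leq_trans (dimvS (subvf _)) _; rewrite dimvf.
Qed.

Lemma dim_cap_orthov U V : (\dim U <= \dim (U :&: V^!) + \dim V)%N.
Proof.
have := dim_cap_lkers (index_enum 'I_(\dim V))
  (fun i => linfun (applyr form (vbasis V)`_i : E -> F^o)) U.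
by rewrite [size _](_ : _ = \dim V) // [index_enum _]unlock -enumT size_enum_ord.
Qed.

Lemma orthovS U V : (U <= V)%VS -> (V^! <= U^!)%VS.
Proof.
move=> sUV; apply/subvP => x /mem_orthovP xV.
by apply/mem_orthovP => u /(subvP sUV) /xV.
Qed.

Lemma orthov_add U V : (U + V)%VS^! = (U^! :&: V^!)%VS.
Proof.
apply/eqP; rewrite eqEsubv; apply/andP; split.
  by rewrite subv_cap !orthovS ?addvSl ?addvSr.
by rewrite orthovD capvSl capvSr.
Qed.

Hypothesis nd : nondegenerate form.

Lemma dim_orthov V : (\dim V^! + \dim V = \dim {:E})%N.
Proof.
apply/eqP; rewrite eqn_leq; apply/andP; split; last first.
  by have := dim_cap_orthov {:E} V; rewrite capfv.
have dX : (\dim (V^!)^C = \dim {:E} - \dim V^!)%N by rewrite dimv_compl.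
have X0 : (V :&: ((V^!)^C)^! = 0)%VS.
  apply/eqP; rewrite -subv0 -(eqP nd) -(addv_complf V^!) orthov_add capvS //.
  by rewrite orthov_sym subvv.
have := dim_cap_orthov V (V^!)^C; rewrite X0 dimv0 add0n dX.
have := dimvS (subvf V^!); move: (\dim V) (\dim V^!) (\dim {:E}) => a b c le_bc.
by rewrite -(leq_add2l b) subnKC.
Qed.

Lemma orthov_cap U V : (U :&: V)%VS^! = (U^! + V^!)%VS.
Proof.
apply/eqP; rewrite eq_sym eqEdim subv_add !orthovS ?capvSl ?capvSr //=.
have := dimv_sum_cap U^! V^!; rewrite -orthov_add.
have := dimv_sum_cap U V; have := dim_orthov U; have := dim_orthov V.
have := dim_orthov (U + V)%VS; have := dim_orthov (U :&: V)%VS.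
lia.
Qed.

Lemma dual_rankP (rho : {vspace E} -> rat) :
  is_q_rank_function rho -> is_q_rank_function (dual_rank form rho).
Proof.
case=> R1 R2 R3.
have R0 V : 0 <= rho V by have /andP[] := R1 V.
(* rho grows by at most the codimension *)
have grow U V : (U <= V)%VS -> rho V + (\dim U)%:R <= rho U + (\dim V)%:R.
  move=> sUV; have := R3 U (V :\: U)%VS; have /andP[_] := R1 (V :\: U)%VS.
  have -> : (U + (V :\: U))%VS = V.
    by rewrite addvC addv_diff; apply/addv_idPl.
  have := dimv_cap_compl V U; rewrite (capv_idPr sUV) => <-; rewrite natrD.
  by have := R0 (U :&: (V :\: U))%VS; lra.
have dimE V : (\dim V^!)%:R + (\dim V)%:R = (\dim {:E})%:R :> rat.
  by rewrite -natrD dim_orthov.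
split=> [V|V W sVW|V W]; rewrite /dual_rank.
- have := grow _ _ (subvf V^!); have := R2 _ _ (subvf V^!); have := dimE V.
  by lra.
- have := grow _ _ (orthovS sVW); have := dimE V; have := dimE W; lra.
- rewrite orthov_add orthov_cap; have := R3 V^! W^!.
  have := congr1 (fun n => n%:R : rat) (dimv_sum_cap V W); rewrite /= !natrD.
  by lra.
Qed.

End DualIsQPolymatroid.

Definition dual_qPolymatroid (F : finFieldType) (E : vectType F)
    (form : {symmetric E}) (nd : nondegenerate form) (M : qPolymatroid E) :
    qPolymatroid E :=
  QPolymatroid (dual_rankP nd (rank_funP M)).

(* Main.v *)
Require Import Defs.
From mathcomp Require Import all_boot all_order all_algebra.
From mathcomp Require Import lra zify.

Import Order.TTheory GRing.Theory Num.Theory.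
Local Open Scope ring_scope.

(** Since the form is symmetric and non-degenerate, perp is an involution of
    the lattice of subspaces (a dimension count, [orthovK]), and it reverses
    inclusions.  Evaluated at the orthogonal of [V], the dual rank is therefore
    the dimension of that space minus the defect [M E - M V], and strong
    independence asks exactly that this defect vanish, i.e., that [V] span
    ([strongly_independent_orthov]).  The equivalence between minimal and
    maximal is then the transport of this first one along the anti-automorphism
    perp: subspaces strictly below [V] correspond to subspaces strictly above
    its orthogonal. *)

Section Perp.
Variables (F : finFieldType) (E : vectType F) (form : {symmetric E}).
Hypothesis nd : nondegenerate form.
Implicit Types V W : {vspace E}.
Local Notation "V ^!" := (orthov form V).

(** Symmetry gives the inclusion of [V] in its double orthogonal;
    non-degeneracy makes both spaces have complementary dimension to the
    orthogonal of [V]. *)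
Lemma orthovK V : V^!^! = V.
Proof.
apply/esym/eqP; rewrite eqEdim orthov_sym subvv /=.
by have := dim_orthov nd V; have := dim_orthov nd V^!; lia.
Qed.

Variable M : qPolymatroid E.

Lemma strongly_independent_orthov V :
  strongly_independent (dual_qPolymatroid nd M) V^! <-> spanning_space M V.
Proof.
rewrite /strongly_independent /spanning_space /= /dual_rank orthovK.
by split=> [|->]; lra.
Qed.

(** The orthogonals of the proper subspaces of [V] are the proper overspaces of
    the orthogonal of [V]. *)
Lemma maximally_strongly_independent_orthov V :
  maximally_strongly_independent (dual_qPolymatroid nd M) V^! <->
  minimal_spanning_space M V.
Proof.
split=> -[/strongly_independent_orthov defV extV]; split=> // W sW neqW.
- move/strongly_independent_orthov; apply: extV; first exact: orthovS.
  by apply: contraNneq neqW => eqVW; rewrite -[W]orthovK -eqVW orthovK.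
- rewrite -[W]orthovK => /strongly_independent_orthov; apply: extV.
    by rewrite -[V]orthovK; apply: orthovS.
  by apply: contraNneq neqW => <-; rewrite orthovK.
Qed.

End Perp.

Theorem proposition5p7 (F : finFieldType) (E : vectType F) (M : qPolymatroid E)
    (form : {symmetric E}%R) (nd : nondegenerate form) (V : {vspace E}) :
  (spanning_space M V <->
     strongly_independent (dual_qPolymatroid nd M) (orthov form V))
  /\
  (minimal_spanning_space M V <->
     maximally_strongly_independent (dual_qPolymatroid nd M) (orthov form V)).
Proof.
split; apply: iff_sym.
- exact: strongly_independent_orthov.
- exact: maximally_strongly_independent_orthov.
Qed.
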